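(* Let $H$ be an $r$-uniform hypergraph whose vertex set is partitioned as $V(H)=V_1\cup V_2$ with $V_1\cap V_2=\emptyset$, such that $|e\cap V_1|=1$ and $|e\cap V_2|=r-1$ for every edge $e\in H$. Then there exist numbers $\beta_u\in\{0,1\}$ for each $u\in V_1$ and $\alpha_e\in\mathbb{R}^+$ (nonnegative reals) for each $e\in H$ such that (1) $\sum_{u\in V_1}\beta_u+\sum_{e\in H}\alpha_e\le\nu(H)$, and (2) the function $\sum_{u\in V_1}\beta_u\chi_{\{u\}}+\sum_{e\in H}\alpha_e\chi_{e\setminus V_1}$ is a fractional cover of $H$.
   Context: $\nu(H)$ is the matching number of $H$ (maximum number of pairwise disjoint edges). For a set $S$ of vertices, $\chi_S$ is its characteristic function. A fractional cover of $H$ is a function assigning a nonnegative real weight to each vertex such that the total weight on every edge is at least $1$. *)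

(* Defs.v *)
From HB Require Import structures.
From mathcomp Require Import all_boot all_order all_algebra.
From mathcomp Require Import reals.

Set Implicit Arguments.
Unset Strict Implicit.
Unset Printing Implicit Defensive.

Import Order.TTheory GRing.Theory Num.Theory.
Local Open Scope ring_scope.

(* A finite hypergraph on the vertex set T is its set of edges H : {set {set T}}. *)

Definition uniform (T : finType) (r : nat) (H : {set {set T}}) : Prop :=
  forall e : {set T}, e \in H -> #|e| = r.

Definition matching (T : finType) (H M : {set {set T}}) : bool :=
  (M \subset H) && trivIset M.

Definition matching_number (T : finType) (H : {set {set T}}) : nat :=
  \max_(M : {set {set T}} | matching H M) #|M|.

Definition charfun (R : realType) (T : finType) (S : {set T}) (v : T) : R :=
  (v \in S)%:R.

Definition fractional_cover (R : realType) (T : finType) (H : {set {set T}})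
    (w : T -> R) : Prop :=
  (forall v : T, 0 <= w v) /\
  (forall e : {set T}, e \in H -> 1 <= \sum_(v in e) w v).

(* Main.v *)
Require Import Defs.
From HB Require Import structures.
From mathcomp Require Import all_boot all_order all_algebra.
From mathcomp Require Import reals.
From mathcomp Require Import boolp lra ring zify.

Set Implicit Arguments.
Unset Strict Implicit.
Unset Printing Implicit Defensive.

Import Order.TTheory GRing.Theory Num.Theory.
Local Open Scope ring_scope.

(** Colour an edge [e] by its vertex in [V1], and say that two edges are in
    conflict when they meet outside [V1]; a matching is a rainbow independent set.
    Let [n = #|V1|] and let [nu] be the matching number. For a set [B] of colours,
    look for [alpha] on the edges coloured in [B] whose total is at most
    [#|B| - (n - nu)] and for which every such edge [e] satisfies
    [\sum_f alpha f * #|e :&: f :\: V1| >= 1]; any such [alpha], with [beta] the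
    indicator of the complement of [B], proves the theorem. If no [B] admits one,
    then linear programming duality gives, for every [B], weights [w >= 0] with
    [M w <= 1] and [\sum w > #|B| - (n - nu)], where [M] is the Gram matrix of
    the sets [e :\: V1].

    Such weights force homology to vanish (Aharoni-Berger-Meshulam). On the
    independence complex weighted by [w], the combinatorial Laplacian on chains
    supported on sets of size [k] is bounded below by [\sum w - k], because [M] is
    positive semidefinite and dominates the conflict relation; hence cycles of size
    [k < \sum w] are boundaries. A topological Hall argument concludes: filling
    cycles successively over all sets of colours, and pushing the result forward to
    the simplex of colours, gives a chain of degree one on the full set of colours,
    so a rainbow independent set exists. The deficiency [n - nu] is absorbed by
    dummy vertices, and the rainbow set obtained is a matching of size [nu + 1]. *)

(** * Linear programming duality *)

(** The elimination step needs a value for one variable: the least upper bound works, else the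
    greatest lower bound, else 0 when both families are empty. *)
Lemma exists_between (R : realFieldType) (I : finType) (P Q : pred I)
    (l u : I -> R) :
  (forall p q, P p -> Q q -> l p <= u q) ->
  exists t, (forall p, P p -> l p <= t) /\ (forall q, Q q -> t <= u q).
Proof.
move=> lu; case: (pickP Q) => [q0 Qq0|Q0].
  case: (arg_minP u Qq0) => q Qq qmin.
  by exists (u q); split=> [p Pp|q' /qmin //]; apply: lu.
case: (pickP P) => [p0 Pp0|P0].
  case: (arg_maxP l Pp0) => p Pp pmax.
  by exists (l p); split=> [p' /pmax //|q]; rewrite Q0.
by exists 0; split=> p; rewrite ?P0 ?Q0.
Qed.

(* Fourier-Motzkin elimination of the variables in [D], one at a time. *)
Lemma farkas (R : realFieldType) (J : finType) (D : {set J}) (I : finType)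
    (a : I -> J -> R) (b : I -> R) :
  (exists x : J -> R, forall i, \sum_(j in D) a i j * x j <= b i) \/
  (exists y : I -> R, [/\ forall i, 0 <= y i,
     forall j, j \in D -> \sum_i y i * a i j = 0 & \sum_i y i * b i < 0]).
Proof.
move: {2}#|D| (erefl #|D|) => n; elim: n => [|n IHn] in D I a b *.
  move/eqP; rewrite cards_eq0 => /eqP->.
  case: (pickP (fun i => b i < 0)) => [i bi|b0]; last first.
    left; exists (fun=> 0) => i; rewrite big_set0 leNgt; exact/negbT/b0.
  right; exists (fun k => (k == i)%:R); split=> [k|j|].
  - exact: ler0n.
  - by rewrite inE.
  - rewrite (bigD1 i) //= eqxx mul1r big1 ?addr0 // => k /negbTE->.
    by rewrite mul0r.
move=> cD; have /card_gt0P [j0 j0D] : (0 < #|D|)%N by rewrite cD.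
have cD' : #|D :\ j0| = n by move: cD; rewrite (cardsD1 j0) j0D => -[].
(* Nonnegative combinations of rows that cancel the coefficient of [j0]: a row already free of [j0],
   or two rows of opposite signs scaled against each other. All remaining indices give the trivial
   row. *)
pose c (k : I + I * I) (i : I) : R := match k with
  | inl p => ((a p j0 == 0) && (i == p))%:R
  | inr (p, q) => if (a p j0 < 0) && (0 < a q j0)
                  then a q j0 * (i == p)%:R - a p j0 * (i == q)%:R else 0
  end.
have delta (F : I -> R) p : \sum_i (i == p)%:R * F i = F p.
  rewrite (bigD1 p) //= eqxx mul1r big1 ?addr0 // => k /negbTE->.
  by rewrite mul0r.
have csum k F : \sum_i c k i * F i = match k with
  | inl p => if a p j0 == 0 then F p else 0
  | inr (p, q) => if (a p j0 < 0) && (0 < a q j0)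
                  then a q j0 * F p - a p j0 * F q else 0
  end.
  case: k => [p|[p q]] /=.
    by case: ifP => _; rewrite ?delta // big1 // => i _; rewrite mul0r.
  case: ifP => _; last by rewrite big1 // => i _; rewrite mul0r.
  rewrite -[in RHS](delta F p) -[in RHS](delta F q) !mulr_sumr -sumrB.
  by apply: eq_bigr => i _; ring.
have c_ge0 k i : 0 <= c k i.
  case: k => [p|[p q]] /=; first exact: ler0n.
  case: ifP => // /andP[ap aq].
  by case: eqP => _; case: eqP => _; rewrite ?mulr1 ?mulr0; lra.
have c0 k : \sum_i c k i * a i j0 = 0.
  rewrite csum; case: k => [p|[p q]]; first by case: eqP.
  by case: ifP => // _; ring.
have [[x xP]|[y [y0 ya yb]]] :=
  IHn _ _ (fun k j => \sum_i c k i * a i j) (fun k => \sum_i c k i * b i) cD'.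
  (* [g i] is what row [i] leaves for [a i j0 * t]. On a pair of rows, [gP] says that the lower
     bound on [t] from one is at most the upper bound from the other. *)
  left; pose g i := b i - \sum_(j in D :\ j0) a i j * x j.
  have gP k : 0 <= \sum_i c k i * g i.
    have := xP k; rewrite -subr_ge0; congr (0 <= _).
    rewrite (eq_bigr (fun j => \sum_i c k i * (a i j * x j))); last first.
      by move=> j _; rewrite mulr_suml; apply: eq_bigr => i _; rewrite mulrA.
    rewrite exchange_big -sumrB; apply: eq_bigr => i _.
    by rewrite mulrBr mulr_sumr.
  have [p q ap aq|t [tl tu]] := @exists_between R I (fun i => a i j0 < 0)
      (fun i => 0 < a i j0) (fun i => g i / a i j0) (fun i => g i / a i j0).
    have := gP (inr (p, q)); rewrite csum ap aq /=.
    rewrite ler_ndivrMr // mulrAC ler_pdivrMr //; lra.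
  exists (fun j => if j == j0 then t else x j) => i.
  rewrite (big_setD1 j0) //= eqxx.
  rewrite (eq_bigr (fun j => a i j * x j)); last first.
    by move=> j; rewrite in_setD1 => /andP[/negbTE->].
  rewrite -lerBrDr -/(g i).
  case: (ltrgtP (a i j0) 0) => [ai|ai|ai].
  - by have := tl i ai; rewrite ler_ndivrMr // mulrC.
  - by have := tu i ai; rewrite ler_pdivlMr // mulrC.
  - by have := gP (inl i); rewrite csum ai eqxx mul0r.
(* A certificate for the eliminated system pulls back along the combinations [c]. *)
right; exists (fun i => \sum_k y k * c k i).
have swap F : \sum_i (\sum_k y k * c k i) * F i
    = \sum_k y k * \sum_i c k i * F i.
  rewrite (eq_bigr (fun i => \sum_k y k * (c k i * F i))); last first.
    by move=> i _; rewrite mulr_suml; apply: eq_bigr => k _; rewrite mulrA.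
  by rewrite exchange_big; apply: eq_bigr => k _; rewrite mulr_sumr.
split=> [i|j jD|].
- by apply: sumr_ge0 => k _; rewrite mulr_ge0.
- rewrite swap; have [->|jj0] := eqVneq j j0.
    by rewrite big1 // => k _; rewrite c0 mulr0.
  by apply: ya; rewrite in_setD1 jj0.
- by rewrite swap.
Qed.

(** Farkas is applied to the covering system with budget [t]. In a certificate with multipliers [v]
    on the covering rows and [s] on the budget row, [v / s] is the dual solution; the positive
    diagonal of [M] excludes [s = 0]. *)
Lemma lp_alternative (R : realFieldType) (J : finType) (A : {set J})
    (M : J -> J -> R) (t : R) :
  (forall i j, 0 <= M i j) -> (forall i, i \in A -> 0 < M i i) ->
  (exists x : J -> R, [/\ forall j, 0 <= x j,
     forall i, i \in A -> 1 <= \sum_(j in A) M i j * x j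
     & \sum_(j in A) x j <= t]) \/
  (exists w : J -> R, [/\ forall i, 0 <= w i,
     forall j, j \in A -> \sum_(i in A) w i * M i j <= 1
     & t < \sum_(i in A) w i]).
Proof.
move=> M0 MA.
pose a (k : J + J + unit) j : R := match k with
  | inl (inl i) => - ((i \in A)%:R * M i j)
  | inl (inr i) => - (i == j)%:R
  | inr _ => 1 end.
pose b (k : J + J + unit) : R := match k with
  | inl (inl i) => - (i \in A)%:R
  | inl (inr i) => 0
  | inr _ => t end.
have [[x xP]|[y [y0 ya yb]]] := farkas A a b.
  (* The system controls [x] only on [A]; elsewhere it is reset to zero to stay nonnegative. *)
  left; exists (fun j => if j \in A then x j else 0); split=> [j|i iA|].
  - case: ifP => // jA; have := xP (inl (inr j)); rewrite /a /b.
    rewrite (big_setD1 j) //= eqxx big1 ?addr0.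
      by rewrite mulN1r oppr_le0.
    by move=> i; rewrite in_setD1 eq_sym => /andP[/negbTE-> _]; rewrite oppr0 mul0r.
  - have := xP (inl (inl i)); rewrite /a /b iA lerNr.
    rewrite -sumrN => h; apply: le_trans h _; apply: ler_sum => j jA.
    by rewrite jA mul1r mulNr opprK.
  - have := xP (inr tt); rewrite /a /b; apply: le_trans.
    by apply: ler_sum => j jA; rewrite jA mul1r.
right; have unit_sum (F : unit -> R) : \sum_k F k = F tt.
  by rewrite (bigD1 tt) //= big1 ?addr0 // => -[].
pose v i := y (inl (inl i)); pose s := y (inr tt).
have vs j : j \in A -> \sum_(i in A) v i * M i j <= s.
  move=> jA; have := ya j jA; rewrite !big_sumType /= unit_sum.
  set s1 := \sum_(i in A) _; set s2 := \sum_i _; set s3 := \sum_i _.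
  have -> : s2 = - s1.
    rewrite /s1 /s2 -sumrN [RHS]big_mkcond; apply: eq_bigr => i _ /=.
    by case: (i \in A); rewrite ?mul1r ?mul0r ?oppr0 ?mulr0 ?mulrN.
  have s3le : s3 <= 0.
    by apply: sumr_le0 => i _; rewrite mulrN oppr_le0 mulr_ge0.
  by rewrite mulr1 -/s; lra.
have vt : s * t < \sum_(i in A) v i.
  move: yb; rewrite !big_sumType /= unit_sum -/s.
  rewrite [X in _ + X + _]big1 ?addr0; last by move=> i _; rewrite mulr0.
  set s2 := \sum_i _; suff -> : s2 = - \sum_(i in A) v i by lra.
  rewrite /s2 -sumrN [RHS]big_mkcond; apply: eq_bigr => i _ /=.
  by case: (i \in A); rewrite ?mulrN1 ?oppr0 ?mulr0.
have : 0 <= s by exact: y0.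
(* If [s = 0], each [v i * M i i] with [i] in [A] is at most zero, so [v] vanishes on [A], against
   [vt]. *)
rewrite le_eqVlt => /orP[/eqP s0|s_gt0].
  move: vt; rewrite -s0 mul0r big1 ?ltxx // => i iA.
  have : v i * M i i <= 0.
    apply: le_trans (_ : \sum_(k in A) v k * M k i <= 0); last by rewrite [leRHS]s0 vs.
    rewrite (bigD1 i) //= lerDl sumr_ge0 // => k _.
    by rewrite mulr_ge0 // /v.
  rewrite pmulr_lle0 ?MA // => vi; apply/eqP.
  by rewrite eq_le vi /v y0.
exists (fun i => v i / s); split=> [i|j jA|].
- by rewrite divr_ge0 // ?y0 // ltW.
- rewrite (eq_bigr (fun i => v i * M i j / s)); last by move=> i _; rewrite mulrAC.
  by rewrite -mulr_suml ler_pdivrMr // mul1r vs.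
- by rewrite -mulr_suml ltr_pdivlMr // mulrC.
Qed.

(** * Chains of an independence complex *)

Lemma linear_ker0_surj (K : fieldType) (vT : vectType K) (f : vT -> vT) :
  linear f -> (forall x, f x = 0 -> x = 0) -> forall y, exists x, f x = y.
Proof.
move=> flin fker y.
pose fL : {linear vT -> vT} := HB.pack f (GRing.isLinear.Build _ _ _ _ f flin).
have ker0 : lker (linfun fL) == 0%VS.
  apply/eqP/vspaceP => x; rewrite memv_ker memv0 lfunE /=.
  apply/idP/idP => [/eqP/fker->//|/eqP->]; apply/eqP; exact: (linear0 fL).
have : y \in limg (linfun fL) by rewrite (lker0_limgf ker0) memvf.
by case/memv_imgP => x _ ->; exists x; rewrite lfunE.
Qed.

Lemma sum_antisym (R : realFieldType) (I : finType) (P : pred I)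
    (F : I -> I -> R) :
  (forall i j, P i -> P j -> F i j = - F j i) ->
  \sum_(i | P i) \sum_(j | P j) F i j = 0.
Proof.
move=> anti; set S := \sum_(i | _) _; suff : S = - S by lra.
rewrite {1}/S exchange_big -sumrN; apply: eq_bigr => i Pi; rewrite -sumrN.
by apply: eq_bigr => j Pj; apply: anti.
Qed.

(** Double counting: a set with a marked element corresponds to a set with a marked non-element.
    This exchanges sums over faces and cofaces throughout. *)
Lemma sum_insert (V : nmodType) (T : finType) (F : T -> {set T} -> V) :
  \sum_(A : {set T}) \sum_(v in A) F v (A :\ v)
  = \sum_(A : {set T}) \sum_(v | v \notin A) F v A.
Proof.
rewrite !pair_big_dep /=.
rewrite (reindex_onto (fun p : {set T} * T => (p.2 |: p.1, p.2))
                      (fun p : {set T} * T => (p.1 :\ p.2, p.2))) /=; last first.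
  by case=> A v /= vA; rewrite setD1K.
apply: eq_big => [[A v]|[A v]] /=.
  rewrite setU11 xpair_eqE eqxx andbT /=.
  apply/eqP/idP => [<-|vA]; last by rewrite setU1K.
  by rewrite setD11.
by rewrite setU11 /= xpair_eqE => /andP[/eqP-> _].
Qed.

(* The sign of [v] in the oriented simplex [v |: A], vertices ordered by [key]. *)
Definition sgn (R : pzRingType) (T : finType) (key : T -> nat) (v : T)
  (A : {set T}) : R := (-1) ^+ #|[set x in A | (key x < key v)%N]|.

Lemma sgnM (R : pzRingType) (T : finType) (key : T -> nat) (v : T)
  (A : {set T}) : sgn R key v A * sgn R key v A = 1.
Proof. by rewrite /sgn -expr2 sqrr_sign. Qed.

Lemma sgnU1 (R : pzRingType) (T : finType) (key : T -> nat) (u v : T)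
    (A : {set T}) : u \notin A ->
  sgn R key v (u |: A) = (-1) ^+ (key u < key v)%N * sgn R key v A.
Proof.
move=> uA; rewrite /sgn -exprD; congr (_ ^+ _).
case: (boolP (key u < key v)%N) => uv.
  have -> : [set x in u |: A | (key x < key v)%N]
          = u |: [set x in A | (key x < key v)%N].
    by apply/setP => x; rewrite !inE; case: eqVneq => [->|].
  by rewrite cardsU1 inE (negbTE uA).
congr #|pred_of_set _|; apply/setP => x; rewrite !inE.
by case: eqVneq => [->|//]; rewrite (negbTE uv) !andbF.
Qed.

Lemma sgn_swap (R : comPzRingType) (T : finType) (key : T -> nat) (u v : T)
    (A : {set T}) : injective key -> u != v -> u \notin A -> v \notin A ->
  sgn R key v (u |: A) * sgn R key u (v |: A) = - (sgn R key u A * sgn R key v A).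
Proof.
move=> kI uv uA vA; rewrite !sgnU1 //.
have : key u != key v by rewrite (inj_eq kI).
by case: ltngtP => // _ _; rewrite ?expr0 ?expr1; ring.
Qed.

(** A chain is its coefficient function on all sets, and degree is cardinality. The empty set counts
    as a simplex, so this is the boundary of the augmented complex. *)
Definition bnd (R : pzRingType) (T : finType) (key : T -> nat)
  (f : {set T} -> R) (A : {set T}) : R :=
  \sum_(v | v \notin A) sgn R key v A * f (v |: A).

Definition weight (R : pzRingType) (T : finType) (w : T -> R) (A : {set T}) : R :=
  \prod_(v in A) w v.

Lemma weightU1 (R : comPzRingType) (T : finType) (w : T -> R) (v : T)
  (A : {set T}) : v \notin A -> weight w (v |: A) = w v * weight w A.
Proof. by move=> vA; rewrite /weight big_setU1. Qed.

(** The guard [u != v] allows a reflexive conflict relation. *)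
Definition indep (T : finType) (a : rel T) (V A : {set T}) : bool :=
  (A \subset V) && [forall u in A, forall v in A, (u != v) ==> ~~ a u v].

Lemma indepP (T : finType) (a : rel T) (V A : {set T}) :
  reflect (A \subset V /\ {in A &, forall u v, u != v -> ~~ a u v})
          (indep a V A).
Proof.
apply: (iffP andP) => -[AV h]; split=> //.
  by move=> u v uA vA uv; have /forall_inP/(_ v vA)/implyP := forall_inP h u uA; apply.
by apply/forall_inP => u uA; apply/forall_inP => v vA; apply/implyP; apply: h.
Qed.

Lemma indepS (T : finType) (a : rel T) (V A B : {set T}) :
  A \subset B -> indep a V B -> indep a V A.
Proof.
move=> AB /indepP[BV h]; apply/indepP; split; first exact: subset_trans BV.
by move=> u v uA vA; apply: h; apply: (subsetP AB).
Qed.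

Lemma indepU1 (T : finType) (a : rel T) (V A : {set T}) (u : T) :
  symmetric a -> indep a V A -> u \in V -> {in A, forall v, ~~ a v u} ->
  indep a V (u |: A).
Proof.
move=> asym /indepP[AV h] uV hu; apply/indepP; split.
  by rewrite subUset sub1set uV.
move=> x y; rewrite !in_setU1 => /predU1P[->|xA] /predU1P[->|yA].
- by rewrite eqxx.
- by move=> _; rewrite asym hu.
- by move=> _; rewrite hu.
- exact: h.
Qed.

(** The conflict form is the positive semidefinite form of [M] minus the form of [N = M - a]. Since
    [N] has nonnegative entries, its form is bounded by its row sums, by [2xy <= x^2 + y^2] on each
    entry. *)
Lemma psd_lower (R : realFieldType) (T : finType) (V : {set T}) (a : rel T)
    (M : T -> T -> R) (w h : T -> R) :
  symmetric a -> (forall u v, M u v = M v u) -> (forall u v, 0 <= M u v) ->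
  (forall g : T -> R, 0 <= \sum_u \sum_v M u v * (g u * g v)) ->
  (forall u v, a u v -> 1 <= M u v) -> (forall v, 0 <= w v) ->
  (forall u, u \notin V -> h u = 0) ->
  - (\sum_u w u * h u ^+ 2 * \sum_(v in V) (M u v - (a u v)%:R) * w v)
  <= \sum_u \sum_v (a u v)%:R * (w u * h u * (w v * h v)).
Proof.
move=> asym Msym M0 Mpsd aM w0 h0.
pose N u v := M u v - (a u v)%:R.
have N0 u v : 0 <= N u v.
  by rewrite subr_ge0; case: (boolP (a u v)) => [/aM|_] //; apply: M0.
have Nsym u v : N u v = N v u by rewrite /N Msym asym.
set Q := \sum_u w u * _ * _; set S := \sum_u \sum_v _.
pose P := \sum_u \sum_v N u v * (w u * h u * (w v * h v)).
have SP : 0 <= S + P.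
  have := Mpsd (fun u => w u * h u); congr (_ <= _).
  rewrite -big_split; apply: eq_bigr => u _ /=.
  by rewrite -big_split; apply: eq_bigr => v _ /=; rewrite /N; ring.
have QE : Q = \sum_(u in V) \sum_(v in V) N u v * (w u * w v) * h u ^+ 2.
  rewrite /Q [RHS]big_mkcond; apply: eq_bigr => u _; case: ifP => uV; last first.
    by rewrite h0 ?uV // expr0n /= mulr0 mul0r.
  by rewrite mulr_sumr; apply: eq_bigr => v _; rewrite /N; ring.
have QE' : Q = \sum_(u in V) \sum_(v in V) N u v * (w u * w v) * h v ^+ 2.
  rewrite QE exchange_big; apply: eq_bigr => u _; apply: eq_bigr => v _.
  by rewrite Nsym [w v * _]mulrC.
have PE : P = \sum_(u in V) \sum_(v in V) N u v * (w u * h u * (w v * h v)).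
  rewrite /P [RHS]big_mkcond; apply: eq_bigr => u _; case: ifP => uV; last first.
    by rewrite big1 // => v _; rewrite h0 ?uV // ; ring.
  rewrite [RHS]big_mkcond; apply: eq_bigr => v _; case: ifP => // vV.
  by rewrite (h0 v) ?vV //; ring.
(* The difference is the sum of [N u v * (w u * w v) * (h u - h v) ^+ 2]. *)
have : 0 <= Q + Q - (P + P).
  rewrite {1}QE QE' PE -!big_split -sumrB /=; apply: sumr_ge0 => u _.
  rewrite -!big_split -sumrB /=; apply: sumr_ge0 => v _.
  rewrite [X in 0 <= X](_ : _ = N u v * (w u * w v) * (h u - h v) ^+ 2); last by ring.
  by rewrite mulr_ge0 ?sqr_ge0 ?mulr_ge0.
lra.
Qed.

(** * The boundary operator on chains *)

Section Boundary.
Variables (R : realFieldType) (T : finType) (key : T -> nat).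
Hypothesis key_inj : injective key.
Local Notation s := (sgn R key).

Lemma eq_bnd (f g : {set T} -> R) : f =1 g -> bnd key f =1 bnd key g.
Proof. by move=> fg A; apply: eq_bigr => v _; rewrite fg. Qed.

Lemma bnd_linear (c : R) (f g : {set T} -> R) (A : {set T}) :
  bnd key (fun B => c * f B + g B) A = c * bnd key f A + bnd key g A.
Proof.
rewrite /bnd mulr_sumr -big_split; apply: eq_bigr => v _ /=; ring.
Qed.

Lemma bnd_neq0 (f : {set T} -> R) (A : {set T}) :
  bnd key f A != 0 -> exists2 v, v \notin A & f (v |: A) != 0.
Proof.
move=> nz; case: (pickP [pred v | (v \notin A) && (f (v |: A) != 0)]) => [v|none].
  by case/andP=> vA fv; exists v.
case/eqP: nz; apply: big1 => v vA; have := none v; rewrite /= vA /=.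
by move/negbFE/eqP->; rewrite mulr0.
Qed.

Lemma bnd_bnd (f : {set T} -> R) (A : {set T}) : bnd key (bnd key f) A = 0.
Proof.
pose F v u := (u != v)%:R * (s v A * (s u (v |: A) * f (u |: (v |: A)))).
transitivity (\sum_(v | v \notin A) \sum_(u | u \notin A) F v u).
  apply: eq_bigr => v vA; rewrite /bnd mulr_sumr big_mkcond [RHS]big_mkcond.
  apply: eq_bigr => u _; rewrite in_setU1 negb_or /F.
  by case: (u != v); case: (u \notin A); rewrite /= ?mul1r ?mul0r.
apply: sum_antisym => v u vA uA; rewrite /F eq_sym.
case: (eqVneq v u) => [->|vu] /=; first by rewrite !mul0r oppr0.
rewrite !sgnU1 // setUCA.
have : key u != key v by rewrite (inj_eq key_inj) eq_sym.
by case: ltngtP => // _ _; rewrite ?expr0 ?expr1; ring.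
Qed.

End Boundary.

(** * The Laplacian of a weighted independence complex *)

Section Energy.

Variables (R : realFieldType) (T : finType) (key : T -> nat) (a : rel T).
Variables (V : {set T}) (M : T -> T -> R) (w : T -> R).

Hypothesis key_inj : injective key.
Hypotheses (a_refl : reflexive a) (a_sym : symmetric a).
Hypothesis M_sym : forall u v, M u v = M v u.
Hypothesis M_ge0 : forall u v, 0 <= M u v.
Hypothesis M_psd : forall g : T -> R, 0 <= \sum_u \sum_v M u v * (g u * g v).
Hypothesis M_ge1 : forall u v, a u v -> 1 <= M u v.
Hypothesis w_gt0 : forall v, 0 < w v.
Hypothesis Mw_le1 : forall u, u \in V -> \sum_(v in V) M u v * w v <= 1.

Local Notation s := (sgn R key).
Local Notation X := (indep a V).
Local Notation wt := (weight w).

Let wt_ge0 A : 0 <= wt A.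
Proof. by apply: prodr_ge0 => v _; apply: ltW. Qed.

(** After bounding [#|B|] below by the total load of [M] from [B], the inequality holds for each [v]
    in [V] separately: either [v] conflicts with a vertex of [B] and the sum of [a] contributes at
    least 1, or [v] lies outside [B] and extends it to a face. *)
Lemma link_lower (B : {set T}) : X B ->
  \sum_(v in V) w v - #|B|%:R <=
  \sum_(v | (v \notin B) && X (v |: B)) w v
  - \sum_(u in B) \sum_(v in V) (M u v - (a u v)%:R) * w v.
Proof.
move=> XB; have [BV Bi] := indepP _ _ _ XB.
have le1 : \sum_(u in B) \sum_(v in V) M u v * w v <= #|B|%:R.
  apply: le_trans (_ : \sum_(u in B) 1 <= _); last by rewrite sumr_const.
  by apply: ler_sum => u uB; apply: Mw_le1; apply: (subsetP BV).
apply: le_trans (_ : \sum_(v in V) w v - \sum_(u in B) \sum_(v in V) M u v * w v <= _).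
  by rewrite lerD2l lerN2.
rewrite exchange_big /= [X in _ <= _ - X]exchange_big /= -sumrB.
have -> : \sum_(v | (v \notin B) && X (v |: B)) w v
    = \sum_(v in V) ((v \notin B) && X (v |: B))%:R * w v.
  rewrite big_mkcond [RHS]big_mkcond; apply: eq_bigr => v _.
  case: andP => [[_ /indepP[+ _]]|_]; last by rewrite mul0r if_same.
  by rewrite subUset sub1set => /andP[-> _]; rewrite mul1r.
rewrite -sumrB; apply: ler_sum => v vV.
rewrite -!mulr_suml -mulrBl -[X in X - _]mul1r -mulrBl ler_wpM2r ?(ltW (w_gt0 _)) //.
rewrite sumrB; case: (pickP [pred u in B | a u v]) => [u /andP[uB uv]|none].
  suff : 1 <= \sum_(i in B) (a i v)%:R :> R.
    by have : 0 <= ((v \notin B) && X (v |: B))%:R :> R by []; lra.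
  by rewrite (bigD1 u) //= uv lerDl sumr_ge0.
have nv u : u \in B -> ~~ a u v.
  by move=> uB; have := none u; rewrite /= uB => /= ->.
have vB : v \notin B by apply/negP => /nv; rewrite a_refl.
have -> : \sum_(i in B) (a i v)%:R = 0 :> R.
  by apply: big1 => u /nv/negbTE->.
by rewrite vB indepU1 //= subr0.
Qed.

(* Bochner-type estimate: once expanded, the two energies differ from a diagonal
   form only by the pairs [u, v] in conflict, because [X] is a flag complex. *)
Lemma energy_lower (k : nat) (phi : {set T} -> R) :
  (forall A, phi A != 0 -> X A /\ #|A| = k) ->
  (\sum_(v in V) w v - k%:R) * \sum_(A : {set T}) wt A * phi A ^+ 2 <=
  \sum_(A | X A) wt A * (\sum_(v in A) s v (A :\ v) * phi (A :\ v)) ^+ 2 +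
  \sum_(A : {set T}) wt A * (\sum_(v | v \notin A) s v A * (w v * phi (v |: A))) ^+ 2.
Proof.
move=> phiX.
set N1 := \sum_(A | X A) _; set N2 := \sum_(A : {set T}) _ * (_ ^+ 2).
(* [D] and [- O] are the diagonal and off-diagonal parts of the expanded square [N1]; the pairs in
   [O] are indexed by the face [C] left after removing both vertices, as in the expansion of
   [N2]. *)
pose g (C : {set T}) u := s u C * (w u * phi (u |: C)).
pose D := \sum_(B : {set T}) \sum_(v | v \notin B) (X (v |: B))%:R * (w v * wt B * phi B ^+ 2).
pose O := \sum_(C : {set T}) \sum_(u | u \notin C) \sum_(v | v \notin C)
  ((v != u) && X (v |: (u |: C)))%:R * (wt C * (g C u * g C v)).
have N1E : N1 = D - O.
  pose G v (B : {set T}) := (X (v |: B))%:R * (w v * wt B * phi B ^+ 2) +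
    \sum_(u in B) (X (v |: B))%:R * (w v * wt B *
      (s v B * s u (v |: (B :\ u)) * (phi B * phi (v |: (B :\ u))))).
  have -> : N1 = \sum_(A : {set T}) \sum_(v in A) G v (A :\ v).
    rewrite /N1 big_mkcond; apply: eq_bigr => A _; case: ifP => XA; last first.
      rewrite big1 // => v vA; rewrite /G setD1K // XA mul0r add0r big1 // => u _.
      by rewrite mul0r.
    rewrite expr2 big_distrlr /= mulr_sumr; apply: eq_bigr => v vA.
    rewrite /G setD1K // XA -weightU1 ?setD11 // setD1K //.
    rewrite (bigD1 v) //= mulrDr; congr (_ + _).
      by rewrite mul1r; rewrite -[RHS]mulr1 -(sgnM R key v (A :\ v)); ring.
    rewrite mulr_sumr; apply: eq_big => [u|u /andP[uA uv]].
      by rewrite in_setD1 andbC.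
    have -> : v |: ((A :\ v) :\ u) = A :\ u.
      apply/setP => x; rewrite !inE; case: (eqVneq x v) => [->|] //=.
        by rewrite eq_sym uv vA.
    by rewrite mul1r; ring.
  rewrite sum_insert.
  have -> : \sum_(A : {set T}) \sum_(v | v \notin A) G v A = D +
     \sum_(A : {set T}) \sum_(u in A) \sum_(v | v \notin A) (X (v |: A))%:R * (w v * wt A *
      (s v A * s u (v |: (A :\ u)) * (phi A * phi (v |: (A :\ u))))).
    rewrite -big_split; apply: eq_bigr => A _ /=.
    by rewrite [X in _ + X]exchange_big -big_split; apply: eq_bigr.
  congr (_ + _).
  pose F u (C : {set T}) := \sum_(v | v \notin u |: C)
    (X (v |: (u |: C)))%:R * (w v * wt (u |: C) *
      (s v (u |: C) * s u (v |: C) * (phi (u |: C) * phi (v |: C)))).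
  have -> : - O = \sum_(C : {set T}) \sum_(u | u \notin C) F u C.
    rewrite /O -sumrN; apply: eq_bigr => C _; rewrite -sumrN; apply: eq_bigr => u uC.
    rewrite -sumrN /F big_mkcond [RHS]big_mkcond; apply: eq_bigr => v _.
    rewrite in_setU1 negb_or; case: (boolP (v \notin C)) => vC; last by rewrite andbF.
    rewrite andbT; case: eqVneq => [->|vu] /=; first by rewrite mul0r oppr0.
    by rewrite sgn_swap // 1?eq_sym // weightU1 // /g; ring.
  rewrite -sum_insert; apply: eq_bigr => A _; apply: eq_bigr => u uA.
  by rewrite /F setD1K.
have N2E : N2 = \sum_(C : {set T}) wt C * \sum_(u | u \notin C) \sum_(v | v \notin C) g C u * g C v.
  by apply: eq_bigr => C _; rewrite expr2 big_distrlr.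
(* When both coefficients are nonzero, [u |: C] and [v |: C] are faces, so their union is a face
   unless [u] and [v] conflict. Reflexivity of [a] keeps the terms [u = v]. *)
have ON : N2 - O = \sum_(C : {set T}) wt C *
    \sum_(u | u \notin C) \sum_(v | v \notin C) (a u v)%:R * (g C u * g C v).
  rewrite N2E -sumrB; apply: eq_bigr => C _; rewrite !mulr_sumr -sumrB.
  apply: eq_bigr => u uC; rewrite !mulr_sumr -sumrB; apply: eq_bigr => v vC.
  case: (eqVneq (phi (u |: C)) 0) => [u0|u0].
    by rewrite /g u0 !(mulr0, mul0r) subrr.
  case: (eqVneq (phi (v |: C)) 0) => [v0|v0].
    by rewrite /g v0 !(mulr0, mul0r) subrr.
  have [Xu _] := phiX _ u0; have [Xv _] := phiX _ v0.
  suff -> : (v != u) && X (v |: (u |: C)) = ~~ a u v.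
    by case: (a u v); rewrite /= ?mul0r ?mul1r ?subr0 ?subrr ?mulr0.
  case: eqVneq => [->|vu] /=; first by rewrite a_refl.
  apply/idP/idP => [/indepP[_]|auv].
    by apply; rewrite ?in_setU1 ?eqxx ?orbT // eq_sym.
  have [vV Xv'] := indepP _ _ _ Xv.
  apply: indepU1 => //; first by apply: (subsetP vV); rewrite setU11.
  move=> x; rewrite in_setU1 => /predU1P[->//|xC].
  by apply: Xv'; rewrite ?in_setU1 ?xC ?eqxx ?orbT //; apply: contraNneq vC => <-.
pose q u := \sum_(v in V) (M u v - (a u v)%:R) * w v.
(* This is [psd_lower] for the signed coefficients of [phi] on the cofaces of [C]. *)
have lowC (C : {set T}) : - \sum_(u | u \notin C) w u * phi (u |: C) ^+ 2 * q u <=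
    \sum_(u | u \notin C) \sum_(v | v \notin C) (a u v)%:R * (g C u * g C v).
  pose h u := if u \notin C then s u C * phi (u |: C) else 0.
  have h0 u : u \notin V -> h u = 0.
    move=> uV; rewrite /h; case: ifP => // _.
    case: (eqVneq (phi (u |: C)) 0) => [->|/phiX[/indepP[+ _]]]; first by rewrite mulr0.
    by rewrite subUset sub1set (negbTE uV).
  have := psd_lower a_sym M_sym M_ge0 M_psd M_ge1 (fun v => ltW (w_gt0 v)) h0.
  congr (- _ <= _).
    rewrite [RHS]big_mkcond; apply: eq_bigr => u _; rewrite /h; case: ifP => _.
      by rewrite exprMn expr2 sgnM mul1r.
    by rewrite expr0n /= mulr0 mul0r.
  rewrite [RHS]big_mkcond; apply: eq_bigr => u _; rewrite {1}/h; case: ifP => _.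
    rewrite [RHS]big_mkcond; apply: eq_bigr => v _; rewrite /h; case: ifP => _.
      by rewrite /g; ring.
    by ring.
  by rewrite big1 // => v _; ring.
have -> : N1 + N2 = D + (N2 - O) by rewrite N1E; ring.
apply: le_trans (_ : D - \sum_(C : {set T}) wt C * \sum_(u | u \notin C) w u * phi (u |: C) ^+ 2 * q u <= _);
  last first.
  rewrite lerD2l ON -sumrN; apply: ler_sum => C _; rewrite -mulrN.
  by apply: ler_wpM2l.
have -> : \sum_(C : {set T}) wt C * \sum_(u | u \notin C) w u * phi (u |: C) ^+ 2 * q u
    = \sum_(A : {set T}) wt A * phi A ^+ 2 * \sum_(u in A) q u.
  pose F u (C : {set T}) := wt (u |: C) * phi (u |: C) ^+ 2 * q u.
  transitivity (\sum_(C : {set T}) \sum_(u | u \notin C) F u C).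
    apply: eq_bigr => C _; rewrite mulr_sumr; apply: eq_bigr => u uC.
    by rewrite /F weightU1 //; ring.
  rewrite -sum_insert; apply: eq_bigr => A _; rewrite mulr_sumr.
  by apply: eq_bigr => u uA; rewrite /F setD1K.
have -> : D = \sum_(A : {set T}) wt A * phi A ^+ 2 * \sum_(v | (v \notin A) && X (v |: A)) w v.
  apply: eq_bigr => A _; rewrite mulr_sumr big_mkcondr; apply: eq_bigr => v _.
  by case: ifP => _; rewrite ?mul1r ?mul0r //; ring.
rewrite -sumrB mulr_sumr; apply: ler_sum => A _; rewrite -mulrBr mulrC.
case: (eqVneq (phi A) 0) => [->|/phiX[XA <-]]; first by rewrite expr0n /= !mulr0 !mul0r.
by apply: ler_wpM2l; [rewrite mulr_ge0 // sqr_ge0 | exact: link_lower].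
Qed.

Local Notation bd := (bnd key).

Let wt_gt0 A : 0 < wt A.
Proof. by apply: prodr_gt0. Qed.

Let wt_neq0 A : wt A != 0.
Proof. exact: lt0r_neq0. Qed.

(* The adjoint of [bnd] on chains of [X], for the inner product
   [\sum_(A : {set T}) f A * g A / wt A]. *)
Definition cobnd (g : {set T} -> R) (A : {set T}) : R :=
  (X A)%:R * \sum_(v in A) s v (A :\ v) * (w v * g (A :\ v)).
Local Notation cb := cobnd.

Lemma eq_cobnd (f g : {set T} -> R) : f =1 g -> cb f =1 cb g.
Proof. by move=> fg A; congr (_ * _); apply: eq_bigr => v _; rewrite fg. Qed.

Lemma cobnd_linear (c : R) (f g : {set T} -> R) (A : {set T}) :
  cb (fun B => c * f B + g B) A = c * cb f A + cb g A.
Proof.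
rewrite /cobnd mulrCA -mulrDr; congr (_ * _).
by rewrite mulr_sumr -big_split; apply: eq_bigr => v _ /=; ring.
Qed.

Lemma cobnd_neq0 (f : {set T} -> R) (A : {set T}) :
  cb f A != 0 -> X A /\ exists2 v, v \in A & f (A :\ v) != 0.
Proof.
move=> nz; split; first by apply: contraNT nz => /negbTE; rewrite /cobnd => ->; rewrite mul0r.
case: (pickP [pred v | (v \in A) && (f (A :\ v) != 0)]) => [v|none].
  by case/andP=> vA fv; exists v.
case/eqP: nz; rewrite /cobnd big1 ?mulr0 // => v vA.
by have := none v; rewrite /= vA /= => /negbFE/eqP->; rewrite !mulr0.
Qed.

Lemma bnd_adjoint (f g : {set T} -> R) : (forall A, f A != 0 -> X A) ->
  \sum_(A : {set T}) bd f A * g A / wt A = \sum_(A : {set T}) f A * cb g A / wt A.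
Proof.
move=> fX; pose F v B := s v B * f (v |: B) * g B / wt B.
transitivity (\sum_(B : {set T}) \sum_(v | v \notin B) F v B).
  by apply: eq_bigr => B _; rewrite /bnd !mulr_suml.
rewrite -sum_insert; apply: eq_bigr => A _.
case: (eqVneq (f A) 0) => [f0|/fX XA].
  by rewrite f0 !mul0r big1 // => v vA; rewrite /F setD1K // f0 mulr0 !mul0r.
rewrite /cobnd XA mul1r mulr_sumr mulr_suml; apply: eq_bigr => v vA.
have := weightU1 w (negbT (setD11 v A)); rewrite /F setD1K // => ->.
by field; rewrite wt_neq0 lt0r_neq0.
Qed.

Let sum_sq0 (h : {set T} -> R) : \sum_(A : {set T}) h A * h A / wt A = 0 -> h =1 fun=> 0.
Proof.
move=> /eqP; rewrite psumr_eq0 => [|A _]; last first.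
  by rewrite divr_ge0 ?(ltW (wt_gt0 _)) // -expr2 sqr_ge0.
move=> /allP h0 A; have := h0 A (mem_index_enum _).
by rewrite /= mulf_eq0 invr_eq0 (negbTE (wt_neq0 A)) orbF mulf_eq0 orbb => /eqP.
Qed.

Variable k : nat.
Hypothesis k_lt : k%:R < \sum_(v in V) w v.

Let supp m (f : {set T} -> R) := forall A, f A != 0 -> X A /\ #|A| = m.

(** Pairing the Laplacian with [f] gives the sum of the squared norms of [cb f] and [bd f]. By
    [energy_lower] this is at least a positive multiple of the squared norm of [f]. *)
Lemma energy_eq0 (f : {set T} -> R) : supp k f ->
  \sum_(A : {set T}) f A * (bd (cb f) A + cb (bd f) A) / wt A = 0 -> f =1 fun=> 0.
Proof.
move=> fk f0.
have E0 : \sum_(A : {set T}) cb f A * cb f A / wt A + \sum_(A : {set T}) bd f A * bd f A / wt A = 0.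
  rewrite -[RHS]f0 [X in X + _](_ : _ = \sum_(A : {set T}) bd (cb f) A * f A / wt A); last first.
    by rewrite bnd_adjoint // => A /cobnd_neq0[].
  rewrite [X in _ + X]bnd_adjoint; last by move=> A /fk[].
  by rewrite -big_split; apply: eq_bigr => A _ /=; ring.
(* Dividing by [wt] passes from the inner product with weights [1 / wt] to the form of
   [energy_lower], with weights [wt]. *)
pose phi A := f A / wt A.
have fphi A : f A = wt A * phi A by rewrite /phi mulrC divfK.
have phik : supp k phi.
  by move=> A; rewrite /phi mulf_eq0 negb_or => /andP[/fk].
have := energy_lower phik.
have -> : \sum_(A | X A) wt A *
    (\sum_(v in A) s v (A :\ v) * phi (A :\ v)) ^+ 2
  = \sum_(A : {set T}) cb f A * cb f A / wt A.
  rewrite big_mkcond; apply: eq_bigr => A _; rewrite /cobnd; case: ifP => XA; last first.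
    by rewrite !mul0r.
  rewrite mul1r (_ : \sum_(v in A) s v (A :\ v) * (w v * f (A :\ v))
     = wt A * \sum_(v in A) s v (A :\ v) * phi (A :\ v)).
    by field; exact: wt_neq0.
  rewrite mulr_sumr; apply: eq_bigr => v vA.
  have := weightU1 w (negbT (setD11 v A)); rewrite setD1K // => ->.
  by rewrite fphi; ring.
have -> : \sum_(A : {set T}) wt A *
    (\sum_(v | v \notin A) s v A * (w v * phi (v |: A))) ^+ 2
  = \sum_(A : {set T}) bd f A * bd f A / wt A.
  apply: eq_bigr => A _.
  have -> : bd f A = wt A * \sum_(v | v \notin A) s v A * (w v * phi (v |: A)).
    rewrite mulr_sumr; apply: eq_bigr => v vA.
    by rewrite fphi weightU1 //; ring.
  by field; exact: wt_neq0.
rewrite E0 pmulr_rle0 ?subr_gt0 // => le0.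
apply: sum_sq0; apply/eqP; rewrite eq_le; apply/andP; split; last first.
  by apply: sumr_ge0 => A _; rewrite divr_ge0 ?(ltW (wt_gt0 _)) // -expr2 sqr_ge0.
rewrite (eq_bigr (fun A => wt A * phi A ^+ 2)) // => A _.
by rewrite !fphi; field; exact: wt_neq0.
Qed.

(** Hodge argument: in size [k] the Laplacian [L] is injective, hence surjective, so [z = L f] for
    some [f]; for a cycle [z] the summand [cb (bd f)] vanishes and [cb f] fills [z]. *)
Lemma cycle_is_boundary (z : {set T} -> R) : supp k z -> bd z =1 (fun=> 0) ->
  exists2 y, supp k.+1 y & bd y =1 z.
Proof.
move=> zk z0; pose Xk A := X A && (#|A| == k).
pose L (f : {set T} -> R) A := bd (cb f) A + cb (bd f) A.
have Llin c f g A : L (fun B => c * f B + g B) A = c * L f A + L g A.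
  rewrite /L (eq_bnd key (cobnd_linear c f g)) bnd_linear.
  by rewrite (eq_cobnd (bnd_linear key c f g)) cobnd_linear; ring.
have eqL f g : f =1 g -> L f =1 L g.
  move=> fg A; rewrite /L (eq_bnd key (eq_cobnd fg)).
  by rewrite (eq_cobnd (eq_bnd key fg)).
pose mask (f : {set T} -> R) A := if Xk A then f A else 0.
(* Acting as the identity off the faces of size [k] makes the Laplacian an endomorphism of the whole
   function space, which avoids a subspace of chains. *)
pose Phi (f : {ffun {set T} -> R^o}) : {ffun {set T} -> R^o} :=
  [ffun A => if Xk A then L (mask f) A else f A].
have masked (f : {set T} -> R) : (forall A, ~~ Xk A -> f A = 0) -> mask f =1 f.
  by move=> f0 A; rewrite /mask; case: ifPn => // /f0->.
have suppk (f : {set T} -> R) : (forall A, ~~ Xk A -> f A = 0) -> supp k f.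
  move=> f0 A fA; have /andP[XA /eqP cA] : Xk A by apply: contraNT fA => /f0->.
  by split.
have [||f Phif] := @linear_ker0_surj R _ Phi _ _ [ffun A => z A].
- move=> c f g; apply/ffunP => A; rewrite !ffunE; case: ifP => // _.
  rewrite -[RHS](Llin c (mask f) (mask g)); apply: eqL => B.
  by rewrite /mask !ffunE; case: ifP => // _; rewrite mulr0 addr0.
- move=> f /ffunP f0.
  have fX A : ~~ Xk A -> f A = 0.
    by move=> /negbTE nA; have := f0 A; rewrite !ffunE nA.
  have f00 : f =1 fun=> 0.
    apply: (energy_eq0 (suppk _ fX)); apply: big1 => A _.
    case: (boolP (Xk A)) => [XA|/fX->]; last by rewrite !mul0r.
    have := f0 A; rewrite !ffunE XA (eqL _ _ (masked _ fX)) /L => ->.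
    by rewrite mulr0 mul0r.
  by apply/ffunP => A; rewrite f00 ffunE.
have fX A : ~~ Xk A -> f A = 0.
  move=> nA; have /ffunP/(_ A) := Phif; rewrite !ffunE (negbTE nA) => ->.
  by apply/eqP; apply: contraNT nA => /zk[XA /eqP cA]; apply/andP.
have fk := suppk _ fX.
have Lf : L f =1 z.
  move=> A; case: (boolP (Xk A)) => XA.
    by have /ffunP/(_ A) := Phif; rewrite !ffunE XA (eqL _ _ (masked _ fX)).
  have -> : z A = 0 by apply/eqP; apply: contraNT XA => /zk[XA /eqP cA]; apply/andP.
  (* Both summands of [L] preserve size and keep the support among the faces, by heredity for [bd]
     and by truncation for [cb]. *)
  rewrite /L [bd _ _](_ : _ = 0); last first.
    apply/eqP; apply: contraNT XA => /bnd_neq0[v vA /cobnd_neq0[XvA [u uvA /fk[_ cA]]]].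
    rewrite /Xk (indepS (subsetUr _ _) XvA) /= -cA.
    by move: (cardsD1 u (v |: A)); rewrite uvA cardsU1 vA => /addnI->.
  rewrite add0r; apply/eqP; apply: contraNT XA => /cobnd_neq0[XA [v vA]].
  case/bnd_neq0=> u uA /fk[_ cA]; rewrite /Xk XA -cA cardsU1 uA.
  by rewrite [X in X == _](cardsD1 v) vA /= eqxx.
exists (cb f).
  move=> A /cobnd_neq0[XA [v vA /fk[_ cA]]]; split=> //.
  by rewrite (cardsD1 v) vA cA.
(* [cb (bd f)] is a cycle because [z] and [bd (cb f)] are; by adjunction its squared norm is the
   pairing of its boundary with [bd f], which is zero. *)
have h0 : cb (bd f) =1 fun=> 0.
  have bh0 : bd (cb (bd f)) =1 fun=> 0.
    move=> A; rewrite -(z0 A) -(eq_bnd key Lf).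
    rewrite -[LHS](addr0) -[X in _ + X](bnd_bnd key_inj (cb f) A) addrC.
    have := bnd_linear key 1 (bd (cb f)) (cb (bd f)) A; rewrite mul1r => <-.
    by apply: eq_bnd => B; rewrite mul1r.
  apply: sum_sq0; rewrite -bnd_adjoint; last by move=> A /cobnd_neq0[].
  by apply: big1 => A _; rewrite bh0 !mul0r.
by move=> A; rewrite -(Lf A) /L h0 addr0.
Qed.

End Energy.

(** * Rainbow independent sets *)

Section Rainbow.

Variables (R : realFieldType) (E C : finType) (c : E -> C) (a : rel E).
Variables (M : E -> E -> R) (C0 : {set C}).

Hypotheses (a_refl : reflexive a) (a_sym : symmetric a).
Hypothesis M_sym : forall u v, M u v = M v u.
Hypothesis M_ge0 : forall u v, 0 <= M u v.
Hypothesis M_psd : forall g : E -> R, 0 <= \sum_u \sum_v M u v * (g u * g v).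
Hypothesis M_ge1 : forall u v, a u v -> 1 <= M u v.

Let keyC (x : C) : nat := enum_rank x.
(* Ordering the vertices by colour first makes [c] monotone, so that it
   preserves signs on rainbow sets. *)
Let keyE (e : E) : nat := (keyC (c e) * #|E| + enum_rank e)%N.

Let keyC_inj : injective keyC.
Proof. by move=> x y /ord_inj/enum_rank_inj. Qed.

Let keyE_lt (x y : E) : (keyC (c x) < keyC (c y))%N -> (keyE x < keyE y)%N.
Proof.
move=> lt; rewrite /keyE; have := ltn_ord (enum_rank x).
move: lt; move: (keyC _) (keyC _) (nat_of_ord _) (nat_of_ord _) => p q i j.
by move: #|E| => n; nia.
Qed.

Let keyE_inj : injective keyE.
Proof.
move=> x y xy.
have cxy : keyC (c x) = keyC (c y).
  case: (ltngtP (keyC (c x)) (keyC (c y))) => // /keyE_lt; rewrite xy ltnn //.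
by move: xy; rewrite /keyE cxy => /addnI/ord_inj/enum_rank_inj.
Qed.

Let sE := sgn R keyE.
Let sC := sgn R keyC.

(** The equality of cardinals encodes injectivity of [c] on [A]. *)
Let rb (A : {set E}) (B : {set C}) := (c @: A == B) && (#|A| == #|B|).

Let rb_inj A B : rb A B -> {in A &, injective c}.
Proof. by case/andP=> /eqP<- /eqP/esym/eqP/imset_injP. Qed.

Lemma sgn_color (A : {set E}) (v : E) : {in A &, injective c} ->
  c v \notin c @: A -> sE v A = sC (c v) (c @: A).
Proof.
move=> cI cv; rewrite /sE /sC /sgn; congr (_ ^+ _).
rewrite -(card_in_imset (f := c)); last first.
  by move=> x y; rewrite !inE => /andP[xA _] /andP[yA _]; apply: cI.
congr #|pred_of_set _|; apply/setP => y; rewrite inE.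
apply/imsetP/andP => [[x]|[/imsetP[x xA ->] lt]].
  rewrite inE => /andP[xA lt] ->; split; first exact: imset_f.
  rewrite ltnNge leq_eqVlt; apply/negP => /orP[/eqP/keyC_inj cvx|/keyE_lt].
    by case/negP: cv; rewrite cvx imset_f.
  by rewrite ltnNge (ltnW lt).
by exists x => //; rewrite inE xA keyE_lt.
Qed.

(* Removing one vertex of the colliding pair or the other gives opposite signs. *)
Lemma collision_cancel (f : {set E} -> R) (A : {set C}) :
  \sum_(B : {set E}) \sum_(v | v \notin B)
    (rb B A && (c v \in A))%:R * (sE v B * f (v |: B)) = 0.
Proof.
pose G (u : E) (D : {set E}) := \sum_(v | v \notin u |: D)
  (rb (u |: D) A && (c u == c v))%:R * (sE v (u |: D) * f (v |: (u |: D))).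
transitivity (\sum_(B : {set E}) \sum_(u in B) G u (B :\ u)).
  apply: eq_bigr => B _; rewrite [RHS](eq_bigr (fun u => \sum_(v | v \notin B)
     (rb B A && (c u == c v))%:R * (sE v B * f (v |: B)))); last first.
    by move=> u uB; rewrite /G setD1K.
  rewrite exchange_big /=; apply: eq_bigr => v _; rewrite -mulr_suml; congr (_ * _).
  case: (boolP (rb B A)) => rbBA /=; last by rewrite big1.
  have cI := rb_inj rbBA; have /andP[/eqP<- _] := rbBA.
  case: imsetP => [[u uB cv]|none].
    rewrite (bigD1 u) //= cv eqxx big1 ?addr0 // => x /andP[xB xu].
    by rewrite (inj_in_eq cI) // (negbTE xu).
  by rewrite big1 // => u uB; case: eqP => // cuv; case: none; exists u.
rewrite sum_insert; apply: big1 => D _.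
pose F u v := (u != v)%:R * ((rb (u |: D) A && (c u == c v))%:R *
  (sE v (u |: D) * f (v |: (u |: D)))).
transitivity (\sum_(u | u \notin D) \sum_(v | v \notin D) F u v).
  apply: eq_bigr => u uD; rewrite /G big_mkcond [RHS]big_mkcond.
  apply: eq_bigr => v _; rewrite in_setU1 negb_or /F eq_sym.
  by case: (u != v); case: (v \notin D); rewrite /= ?mul1r ?mul0r.
apply: sum_antisym => u v uD vD; rewrite /F [v == u]eq_sym [c v == _]eq_sym.
case: (eqVneq u v) => [->|uv] /=; first by rewrite !mul0r oppr0.
case: (eqVneq (c u) (c v)) => [cuv|_]; last by rewrite !andbF !mul0r !mulr0 oppr0.
have rbE : rb (u |: D) A = rb (v |: D) A.
  by rewrite /rb !imsetU1 !cardsU1 uD vD cuv.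
rewrite rbE; case: (boolP (rb (v |: D) A)) => [rbv|_]; last by rewrite !mul0r !mulr0 oppr0.
have cI := rb_inj rbv.
have cD : c v \notin c @: D.
  apply/imsetP => -[x xD cvx]; case/negP: vD.
  by rewrite (cI v x) ?setU11 ?in_setU1 ?xD ?orbT.
have cDI : {in D &, injective c}.
  by move=> x y xD yD; apply: cI; rewrite in_setU1 ?xD ?yD orbT.
have suv : sE u D = sE v D by rewrite !sgn_color // cuv.
rewrite /sE !sgnU1 // -/sE suv setUCA.
have : keyE u != keyE v by rewrite (inj_eq keyE_inj).
by case: ltngtP => // _ _; rewrite ?expr0 ?expr1; ring.
Qed.

(** A set that is rainbow on [B] loses colour [b] by deleting exactly one of its vertices. *)
Lemma rainbow_extend (f : {set E} -> R) (B : {set C}) (b : C) : b \in B ->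
  \sum_(A : {set E}) \sum_(v | v \notin A)
     (rb A (B :\ b) && (c v == b))%:R * f (v |: A)
  = \sum_(A | rb A B) f A.
Proof.
move=> bB.
pose F v A := (rb A (B :\ b) && (c v == b))%:R * f (v |: A).
rewrite -(sum_insert F) [RHS]big_mkcond; apply: eq_bigr => A _.
rewrite (eq_bigr (fun v => (rb (A :\ v) (B :\ b) && (c v == b))%:R * f A)); last first.
  by move=> v vA; rewrite /F setD1K.
rewrite -mulr_suml.
have rbD v : v \in A -> c v = b -> rb (A :\ v) (B :\ b) -> rb A B.
  move=> vA cv /andP[/eqP cA /eqP cardA]; apply/andP; split.
    by rewrite -(setD1K vA) imsetU1 cA cv setD1K.
  by rewrite (cardsD1 v A) vA (cardsD1 b B) bB cardA.
case: ifP => [rbA|nrb]; last first.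
  rewrite big1 ?mul0r // => v vA; case: eqP => [cv|_]; last by rewrite andbF.
  by rewrite andbT; case: (boolP (rb _ _)) => // /(rbD _ vA cv); rewrite nrb.
have cI := rb_inj rbA; have /andP[/eqP cA /eqP cardA] := rbA.
have /imsetP[v vA bv] : b \in c @: A by rewrite cA.
rewrite (bigD1 v) //= -bv eqxx andbT big1 ?addr0; last first.
  by move=> x /andP[xA xv]; rewrite bv (inj_in_eq cI) // (negbTE xv) andbF.
suff -> : rb (A :\ v) (B :\ b) by rewrite mul1r.
apply/andP; split; last first.
  by move: cardA; rewrite (cardsD1 v A) vA (cardsD1 b B) bB => /addnI->.
rewrite -cA; apply/eqP/setP => y; rewrite in_setD1.
apply/imsetP/andP => [[x]|[yb /imsetP[x xA yx]]].
  rewrite in_setD1 => /andP[xv xA] ->; rewrite imset_f //; split=> //.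
  by rewrite bv (inj_in_eq cI).
exists x => //; rewrite in_setD1 xA andbT.
by apply: contraNneq yb => xv; rewrite yx xv bv.
Qed.

Hypothesis weights : forall B : {set C}, B \subset C0 -> B != set0 ->
  exists w : E -> R, [/\ forall e, 0 < w e,
    forall u, c u \in B -> \sum_(v | c v \in B) M u v * w v <= 1
    & #|B|%:R - 1 < \sum_(v | c v \in B) w v].

Let X (B : {set C}) := indep a (c @^-1: B).

(** The chains [z B] form a chain map from the simplex of colours to the independence complexes. At
    each new [B], the combination prescribed as boundary is a cycle of size [#|B| - 1], which the
    weights for [B] allow to be filled. *)
Lemma chain_system (n : nat) : exists z : {set C} -> {set E} -> R,
  (forall A, z set0 A = (A == set0)%:R) /\
  forall B : {set C}, B \subset C0 -> (#|B| <= n)%N ->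
    (forall A, z B A != 0 -> X B A /\ #|A| = #|B|) /\
    (forall A,
       bnd keyE (z B) A = \sum_(u in B) sC u (B :\ u) * z (B :\ u) A).
Proof.
elim: n => [|n [z [z0 zP]]].
  exists (fun B A => (A == set0)%:R); split=> // B _.
  rewrite leqn0 cards_eq0 => /eqP->; split=> A; last first.
    rewrite big_set0; apply: big1 => v vA.
    by rewrite -cards_eq0 cardsU1 vA mulr0.
  case: (A =P set0) => [-> _|_]; last by rewrite eqxx.
  rewrite !cards0; split=> //; apply/indepP; split; first exact: sub0set.
  by move=> u v; rewrite inE.
(* The statement is made for every [B], with a zero default where nothing is required, so that the
   fillings can be chosen simultaneously. *)
have ex (B : {set C}) : exists y : {set E} -> R, B \subset C0 -> #|B| = n.+1 ->
    (forall A, y A != 0 -> X B A /\ #|A| = #|B|) /\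
    (forall A, bnd keyE y A = \sum_(u in B) sC u (B :\ u) * z (B :\ u) A).
  case: (boolP ((B \subset C0) && (#|B| == n.+1))) => [/andP[BC /eqP cB]|no]; last first.
    by exists (fun=> 0) => BC cB; rewrite BC cB eqxx in no.
  have B0 : B != set0 by rewrite -cards_eq0 cB.
  have [w [w_gt0 Mw_le1 wB]] := weights BC B0.
  have cD u : u \in B -> #|B :\ u| = n.
    by move=> uB; move: cB; rewrite (cardsD1 u) uB => -[].
  have zD u : u \in B -> (forall A, z (B :\ u) A != 0 -> X (B :\ u) A /\ #|A| = n).
    move=> uB A /(proj1 (zP _ (subset_trans (subsetDl _ _) BC) _)).
    by rewrite cD //; apply.
  pose zeta A := \sum_(u in B) sC u (B :\ u) * z (B :\ u) A.
  have Mw u : u \in c @^-1: B -> \sum_(v in c @^-1: B) M u v * w v <= 1.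
    rewrite inE => /Mw_le1; congr (_ <= _); apply: eq_bigl => v; by rewrite inE.
  have kw : n%:R < \sum_(v in c @^-1: B) w v.
    move: wB; rewrite cB -natr1 addrK; congr (_ < _); apply: eq_bigl => v.
    by rewrite inE.
  have zetaX A : zeta A != 0 -> X B A /\ #|A| = n.
    move=> nz; case: (pickP [pred u in B | z (B :\ u) A != 0]) => [u /andP[uB]|none].
      case/(zD _ uB) => /indepP[AV Ai] cA; split=> //; apply/indepP; split=> //.
      by apply: subset_trans AV _; rewrite preimsetS // subsetDl.
    case/eqP: nz; apply: big1 => u uB; have := none u.
    by rewrite /= uB /= => /negbFE/eqP->; rewrite mulr0.
  (* By the induction hypothesis this is the identity that the boundary squares to zero in the
     simplex of colours. *)
  have zeta0 : bnd keyE zeta =1 fun=> 0.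
    move=> A.
    have -> : bnd keyE zeta A = \sum_(u in B) sC u (B :\ u) * bnd keyE (z (B :\ u)) A.
      transitivity (\sum_(v | v \notin A) \sum_(u in B)
          sC u (B :\ u) * (sgn R keyE v A * z (B :\ u) (v |: A))).
        apply: eq_bigr => v _; rewrite /zeta mulr_sumr; apply: eq_bigr => u _; ring.
      by rewrite exchange_big /=; apply: eq_bigr => u _; rewrite mulr_sumr.
    pose F u v := (u != v)%:R *
      (sC u (B :\ u) * (sC v (B :\ u :\ v) * z (B :\ u :\ v) A)).
    transitivity (\sum_(u in B) \sum_(v in B) F u v).
      apply: eq_bigr => u uB.
      have [_ ->] := zP (B :\ u) (subset_trans (subsetDl _ _) BC) (eq_leq (cD _ uB)).
      rewrite mulr_sumr big_mkcond [RHS]big_mkcond; apply: eq_bigr => v _.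
      rewrite in_setD1 /F eq_sym.
      by case: (u != v); case: (v \in B); rewrite /= ?mul1r ?mul0r.
    apply: sum_antisym => u v uB vB; rewrite /F [v == u]eq_sym.
    case: (eqVneq u v) => [->|uv] /=; first by rewrite !mul0r oppr0.
    set D := B :\ u :\ v.
    have DE : B :\ v :\ u = D by rewrite /D !setDDl setUC.
    have Bu : B :\ u = v |: D by rewrite /D setD1K // in_setD1 eq_sym uv.
    have Bv : B :\ v = u |: D by rewrite -DE setD1K // in_setD1 uv.
    have vD : v \notin D by rewrite setD11.
    have uD : u \notin D by rewrite -DE setD11.
    rewrite DE Bu Bv /sC !sgnU1 //.
    have : keyC u != keyC v by rewrite (inj_eq keyC_inj).
    by case: ltngtP => // _ _; rewrite ?expr0 ?expr1; ring.
  have [y yX yb] := cycle_is_boundary keyE_inj a_refl a_sym M_sym M_ge0 M_psd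
    M_ge1 w_gt0 Mw kw zetaX zeta0.
  by exists y => _ _; rewrite cB.
have [y yP] := fin_all_exists ex.
exists (fun B : {set C} => if #|B| == n.+1 then y B else z B); split.
  by move=> A; rewrite cards0.
move=> B BC; rewrite leq_eqVlt => /predU1P[cB|ltB].
  rewrite cB eqxx; have [yX yb] := yP B BC cB; split; first by rewrite -cB.
  move=> A; rewrite yb; apply: eq_bigr => u uB.
  suff -> : (#|B :\ u| == n.+1) = false by [].
  by move: cB; rewrite (cardsD1 u) uB add1n => -[->]; rewrite ltn_eqF.
have [zX zb] := zP B BC ltB; rewrite (ltn_eqF ltB); split=> // A.
rewrite zb; apply: eq_bigr => u uB.
suff -> : (#|B :\ u| == n.+1) = false by [].
by rewrite ltn_eqF // (leq_ltn_trans _ ltB) // subset_leq_card // subsetDl.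
Qed.

Theorem rainbow_indep : exists A : {set E},
  [/\ indep a setT A, {in A &, injective c} & c @: A = C0].
Proof.
have [z [z0 zP]] := chain_system #|C0|.
(* [pi1] says that the push-forward of [z B] to the simplex of colours has degree one; a nonzero
   coefficient at [C0] then exhibits the rainbow set. *)
suff pi1 n (B : {set C}) : B \subset C0 -> #|B| = n -> \sum_(A | rb A B) z B A = 1.
  have : \sum_(A | rb A C0) z C0 A != 0 by rewrite (pi1 _ _ (subxx _) erefl) oner_eq0.
  case: (pickP [pred A | rb A C0 && (z C0 A != 0)]) => [A /andP[rbA zA] _|none].
    have [/(_ A zA)[/indepP[_ Ai] _] _] := zP C0 (subxx _) (leqnn _).
    exists A; split; first by apply/indepP; split; first exact: subsetT.
      exact: rb_inj rbA.
    by case/andP: rbA => /eqP.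
  case/eqP; apply: big1 => A rbA; have := none A.
  by rewrite /= rbA /= => /negbFE/eqP.
elim: n B => [|n IHn] B BC cB.
  move/eqP: cB; rewrite cards_eq0 => /eqP->.
  rewrite (bigD1 set0) /=; last by rewrite /rb imset0 !cards0 !eqxx.
  rewrite z0 eqxx big1 ?addr0 // => A /andP[/andP[_ +] nA].
  by rewrite cards0 cards_eq0 (negbTE nA).
have /card_gt0P [b bB] : (0 < #|B|)%N by rewrite cB.
have cBb : #|B :\ b| = n by move: cB; rewrite (cardsD1 b) bB => -[].
have BbC := subset_trans (subsetDl B [set b]) BC.
have [zX zb] := zP B BC (subset_leq_card BC).
set S := sC b (B :\ b).
have S2 : S * S = 1 by rewrite /S /sC sgnM.
(* Only the facet [B :\ b] contributes: a face of [X (B :\ u)] carries no vertex of colour [u], so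
   for [u != b] it cannot be rainbow on [B :\ b]. *)
have : \sum_(A | rb A (B :\ b)) bnd keyE (z B) A = S.
  transitivity (\sum_(u in B) \sum_(A | rb A (B :\ b)) sC u (B :\ u) * z (B :\ u) A).
    by rewrite exchange_big; apply: eq_bigr => A _; apply: zb.
  rewrite (bigD1 b) //= -mulr_sumr IHn // mulr1 big1 ?addr0 // => u /andP[uB ub].
  apply: big1 => A /andP[/eqP cA _]; case: (eqVneq (z (B :\ u) A) 0) => [->|nz].
    by rewrite mulr0.
  have BuC := subset_trans (subsetDl B [set u]) BC.
  have [/(_ A nz)[/indepP[AV _] _] _] := zP _ BuC (subset_leq_card BuC).
  have : u \in c @: A by rewrite cA in_setD1 ub.
  case/imsetP=> x xA ux; have := subsetP AV x xA.
  by rewrite !inE -ux eqxx.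
(* The same coefficient computed by adding a vertex: colour [b] gives the rainbow sets on [B],
   repeated colours cancel in pairs, and colours outside [B] lie off the support. *)
have -> : \sum_(A | rb A (B :\ b)) bnd keyE (z B) A = S * \sum_(A | rb A B) z B A.
  rewrite -(rainbow_extend (z B) bB) mulr_sumr -[RHS]addr0.
  rewrite -[X in _ = _ + X](collision_cancel (z B) (B :\ b)) -big_split /=.
  rewrite big_mkcond; apply: eq_bigr => A _; rewrite /bnd.
  case: (boolP (rb A (B :\ b))) => rbA; last first.
    by rewrite !big1 ?mulr0 ?addr0 // => v _; rewrite mul0r.
  rewrite mulr_sumr -big_split; apply: eq_bigr => v vA /=.
  have cI := rb_inj rbA; have /andP[/eqP cA _] := rbA.
  case: (eqVneq (c v) b) => [cv|cv].
    rewrite cv setD11 mul0r addr0 mul1r; congr (_ * _).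
    by rewrite -/(sE v A) sgn_color // cA cv // setD11.
  rewrite mul0r mulr0 add0r in_setD1 cv /=.
  case: (boolP (c v \in B)) => cvB; first by rewrite mul1r.
  rewrite mul0r; case: (eqVneq (z B (v |: A)) 0) => [->|/zX[/indepP[+ _] _]].
    by rewrite mulr0.
  by rewrite subUset sub1set inE (negbTE cvB).
move=> SS; have : S * (S * \sum_(A | rb A B) z B A) = S * S by rewrite SS.
by rewrite mulrA S2 mul1r.
Qed.

End Rainbow.

(** The Laplacian argument divides by weights. Raising all of them by [del] and rescaling by
    [1 + del * K] keeps the loads at most 1; the choice of [del] makes [t * (1 + del * K)] at most
    [W - del]. *)
Lemma positive_weights (R : realFieldType) (E : finType) (P : pred E)
    (M : E -> E -> R) (w : E -> R) (t : R) :
  (forall u v, 0 <= M u v) -> (forall v, 0 <= w v) ->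
  (forall u, P u -> \sum_(v | P v) M u v * w v <= 1) ->
  t < \sum_(v | P v) w v ->
  exists w' : E -> R, [/\ forall v, 0 < w' v,
    forall u, P u -> \sum_(v | P v) M u v * w' v <= 1
    & t < \sum_(v | P v) w' v].
Proof.
move=> M0 w0 Mw tw; set W := \sum_(v | P v) w v in tw.
pose K := \sum_u \sum_v M u v.
have K0 : 0 <= K by do 2!apply: sumr_ge0 => ? _.
have rowK u : \sum_(v | P v) M u v <= K.
  apply: le_trans (_ : \sum_v M u v <= K).
    by rewrite [leRHS](bigID P) /= lerDl sumr_ge0.
  by rewrite /K [leRHS](bigD1 u) //= lerDl sumr_ge0 // => x _; apply: sumr_ge0.
have tK : 0 < `|t| * K + 1 by rewrite ltr_pwDr // mulr_ge0.
pose del := (W - t) / (`|t| * K + 1).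
have del0 : 0 < del by rewrite divr_gt0 // subr_gt0.
have den : 0 < 1 + del * K by rewrite ltr_pwDl // mulr_ge0 // ltW.
exists (fun v => (w v + del) / (1 + del * K)); split=> [v|u Pu|].
- by rewrite divr_gt0 // ltr_pwDr.
- rewrite (eq_bigr (fun v => (M u v * w v + del * M u v) / (1 + del * K))); last first.
    by move=> v _; rewrite mulrA; congr (_ / _); ring.
  rewrite -mulr_suml ler_pdivrMr // mul1r big_split /= -mulr_sumr lerD ?Mw //.
  by rewrite ler_wpM2l // ltW.
- rewrite -mulr_suml ltr_pdivlMr //.
  apply: lt_le_trans (_ : W <= _); last first.
    by apply: ler_sum => v _; rewrite lerDl ltW.
  have : del * (`|t| * K + 1) = W - t by rewrite divfK // gt_eqF.
  have : t * (del * K) <= `|t| * (del * K).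
    by rewrite ler_wpM2r ?ler_norm // mulr_ge0 // ltW.
  by clearbody del W K; lra.
Qed.

(** * Rainbow sets missing at most [d] colours *)

Section Deficiency.

Variables (R : realFieldType) (E C : finType) (c : E -> C) (a : rel E).
Variables (M : E -> E -> R) (C0 : {set C}) (d : nat).

Hypotheses (a_refl : reflexive a) (a_sym : symmetric a).
Hypothesis M_sym : forall u v, M u v = M v u.
Hypothesis M_ge0 : forall u v, 0 <= M u v.
Hypothesis M_psd : forall g : E -> R, 0 <= \sum_u \sum_v M u v * (g u * g v).
Hypothesis M_ge1 : forall u v, a u v -> 1 <= M u v.
Hypothesis weights : forall B : {set C}, B \subset C0 -> B != set0 ->
  exists w : E -> R, [/\ forall e, 0 <= w e,
    forall u, c u \in B -> \sum_(v | c v \in B) M u v * w v <= 1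
    & #|B|%:R - d.+1%:R < \sum_(v | c v \in B) w v].

(* [d] dummy vertices of each colour, the [j]-th ones being in mutual conflict:
   they raise every fractional bound by [d], and a rainbow set uses at most [d]. *)
Theorem rainbow_indep_deficiency : exists A : {set E},
  [/\ indep a setT A, {in A &, injective c}, c @: A \subset C0
    & (#|C0| <= #|A| + d)%N].
Proof.
pose E' := (E + 'I_d * C)%type.
pose c' (x : E') : C := match x with inl e => c e | inr p => p.2 end.
pose a' (x y : E') : bool := match x, y with
  | inl e, inl f => a e f | inr p, inr q => p.1 == q.1 | _, _ => false end.
pose M' (x y : E') : R := match x, y with
  | inl e, inl f => M e f | inr p, inr q => (p.1 == q.1)%:R | _, _ => 0 end.
have [||||||B BC B0|A [/indepP[_ Ai] AI AC]] := @rainbow_indep R E' C c' a' M' C0.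
- by case=> [e|p] /=.
- by case=> [e|p] [f|q] //=; rewrite eq_sym.
- by case=> [e|p] [f|q] //=; rewrite eq_sym.
- by case=> [e|p] [f|q] //=.
- move=> g; rewrite big_sumType /=.
  apply: addr_ge0.
    rewrite (eq_bigr (fun u => \sum_v M u v * (g (inl u) * g (inl v)))) //.
    move=> u _; rewrite big_sumType /= [X in _ + X]big1 ?addr0 // => q _.
    by rewrite mul0r.
  rewrite (eq_bigr (fun p => \sum_(q : 'I_d * C) (p.1 == q.1)%:R
      * (g (inr p) * g (inr q)))); last first.
    move=> p _; rewrite big_sumType /= [X in X + _]big1 ?add0r // => q _.
    by rewrite mul0r.
  have pairE (F : 'I_d * C -> R) : \sum_p F p = \sum_j \sum_x F (j, x).
    by rewrite pair_bigA; apply: eq_bigr => -[].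
  (* The dummy block splits by layer, and on each layer the form is the square of a sum. *)
  rewrite pairE; apply: sumr_ge0 => i _.
  rewrite (eq_bigr (fun y => g (inr (i, y)) * \sum_x g (inr (i, x)))).
    by rewrite -mulr_suml -expr2 sqr_ge0.
  move=> y _; rewrite pairE (bigD1 i) //= [X in _ + X]big1 ?addr0.
    by rewrite mulr_sumr; apply: eq_bigr => x _; rewrite eqxx mul1r.
  by move=> j ji; rewrite big1 // => x _; rewrite eq_sym (negbTE ji) mul0r.
- by case=> [e|p] [f|q] //= => [/M_ge1//|->].
- have [w0 [w00 Mw0 wB0]] := weights BC B0.
  have [w [w_gt0 Mw wB]] := positive_weights M_ge0 w00 Mw0 wB0.
  have cB : 0 < #|B|%:R :> R by rewrite ltr0n card_gt0.
  have sumB : \sum_(x in B) (#|B|%:R)^-1 = 1 :> R.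
    by rewrite sumr_const -[LHS]mulr_natr mulVf // gt_eqF.
  (* With weight [1 / #|B|], each of the [d] layers has total weight exactly 1 on the colours of
     [B], which saturates its load and raises the total by [d]. *)
  exists (fun x => match x with inl e => w e | inr _ => (#|B|%:R)^-1 end); split.
  + by case=> [e|p] //; rewrite invr_gt0.
  + case=> [e|[i y]] /= cu; rewrite big_sumType /=.
      rewrite [X in _ + X]big1 ?addr0; first exact: Mw.
      by move=> q _; rewrite mul0r.
    rewrite [X in X + _]big1 ?add0r; last by move=> q _; rewrite mul0r.
    rewrite -(pair_big_dep predT (fun j x => x \in B)
      (fun j x => (i == j)%:R * (#|B|%:R)^-1)) /=.
    rewrite (bigD1 i) //= [X in _ + X]big1 ?addr0.
      by rewrite -mulr_sumr sumB eqxx mulr1.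
    by move=> j ji; rewrite big1 // => x _; rewrite eq_sym (negbTE ji) mul0r.
  + rewrite big_sumType /=.
    rewrite -(pair_big_dep predT (fun (j : 'I_d) x => x \in B)
      (fun j x => (#|B|%:R)^-1)) /= sumB sumr_const card_ord.
    by move: wB; rewrite -natr1; lra.
pose A1 := [set e | inl e \in A]; pose A2 := [set p | inr p \in A].
exists A1; split.
- apply/indepP; split; first exact: subsetT.
  by move=> u v; rewrite !inE => uA vA uv; apply: (Ai (inl u) (inl v)).
- by move=> u v; rewrite !inE => uA vA cuv; have [] := AI (inl u) (inl v) uA vA cuv.
- apply/subsetP => y /imsetP[e]; rewrite inE => eA ->.
  by rewrite -AC; apply/imsetP; exists (inl e).
rewrite -AC card_in_imset //.
have -> : A = inl @: A1 :|: inr @: A2.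
  apply/setP => -[e|p]; rewrite inE.
    rewrite mem_imset ?inE; last by move=> x y [].
    by case: imsetP => [[]//|_]; rewrite orbF.
  rewrite [X in _ || X]mem_imset ?inE; last by move=> x y [].
  by case: imsetP => [[]//|_].
apply: leq_trans (leq_card_setU _ _) _.
rewrite !card_imset ?leq_add2l; try by move=> x y [].
(* Dummies in [A] do not conflict, so they lie in distinct layers. *)
rewrite -[X in (_ <= X)%N]card_ord -(card_in_imset (f := fst) (D := A2)) ?max_card //.
move=> p q; rewrite !inE => pA qA pq; apply/eqP; apply: contraT => npq.
by have := Ai (inr p) (inr q) pA qA; rewrite /= pq eqxx; apply; apply: contra npq => /eqP[->].
Qed.

End Deficiency.

(** * Bipartite hypergraphs *)

Lemma matching_number_ge (T : finType) (H M : {set {set T}}) :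
  M \subset H -> trivIset M -> (#|M| <= matching_number H)%N.
Proof.
move=> MH tM; rewrite /matching_number.
have mM : matching H M by rewrite /matching MH.
exact: (leq_bigmax_cond (F := fun N : {set {set T}} => #|N|) M mM).
Qed.

Lemma cover_weight (R : realType) (T : finType) (H : {set {set T}})
    (V1 : {set T}) (beta : T -> R) (alpha : {set T} -> R) (e : {set T}) :
  \sum_(v in e) (\sum_(u in V1) beta u * charfun R [set u] v
     + \sum_(f in H) alpha f * charfun R (f :\: V1) v)
  = \sum_(u in e :&: V1) beta u
    + \sum_(f in H) alpha f * #|(e :\: V1) :&: (f :\: V1)|%:R.
Proof.
rewrite big_split /=; congr (_ + _).
  rewrite (eq_bigr (fun v => if v \in V1 then beta v else 0)) -?big_mkcondr.
    by apply: eq_bigl => v; rewrite inE.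
  move=> v _; case: ifP => vV; last first.
    apply: big1 => u uV; rewrite /charfun in_set1; case: eqP => [vu|_]; last by rewrite mulr0.
    by rewrite vu uV in vV.
  rewrite (bigD1 v) //= /charfun in_set1 eqxx mulr1 big1 ?addr0 // => u /andP[_ uv].
  by rewrite in_set1 eq_sym (negbTE uv) mulr0.
rewrite exchange_big; apply: eq_bigr => f _ /=; rewrite -mulr_sumr; congr (_ * _).
rewrite -sum1_card natr_sum big_mkcond [RHS]big_mkcond /=; apply: eq_bigr => v _.
by rewrite /charfun !inE; do 3!case: (_ \in _).
Qed.

(** The case where the sets [e :\: V1] are empty, so that edges have zero Gram diagonal. Here [H] is
    itself a matching, and its indicator on [V1] is the cover. *)
Lemma cover_of_singletons (R : realType) (T : finType) (H : {set {set T}})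
    (V1 : {set T}) :
  (forall e, e \in H -> #|e| = 1%N) -> (forall e, e \in H -> #|e :&: V1| = 1%N) ->
  exists (beta : T -> R) (alpha : {set T} -> R),
    [/\ forall u : T, u \in V1 -> beta u = 0 \/ beta u = 1,
        forall e : {set T}, e \in H -> 0 <= alpha e,
        \sum_(u in V1) beta u + \sum_(e in H) alpha e <= (matching_number H)%:R
      & fractional_cover H (fun v : T =>
          \sum_(u in V1) beta u * charfun R [set u] v
          + \sum_(e in H) alpha e * charfun R (e :\: V1) v)].
Proof.
move=> H1 HV1.
exists (fun u => ([set u] \in H)%:R), (fun=> 0); split=> //.
- by move=> u _; case: (_ \in H); [right|left].
- rewrite [X in _ + X]big1 // addr0 -natr_sum ler_nat.
  apply: leq_trans (matching_number_ge (subxx H) _); last first.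
    apply/trivIsetP => A B /H1/eqP/cards1P[x ->] /H1/eqP/cards1P[y ->] xy.
    by rewrite disjoints1 in_set1; apply: contraNneq xy => ->.
  rewrite -big_mkcondr sum1_card /=.
  rewrite -(card_imset _ set1_inj); apply: subset_leq_card.
  by apply/subsetP => A /imsetP[x + ->]; rewrite unfold_in => /andP[].
split=> [v|e eH].
  apply: addr_ge0; first by apply: sumr_ge0 => u _; rewrite mulr_ge0 ?ler0n.
  by apply: sumr_ge0 => f _; rewrite mul0r.
rewrite cover_weight [X in _ + X]big1 ?addr0; last by move=> f _; rewrite mul0r.
have /eqP/cards1P[x eE] := H1 e eH; have := HV1 e eH.
case: (boolP (x \in V1)) => xV1; last first.
  by rewrite eE (disjoint_setI0 _) ?cards0 // disjoints1.
rewrite eE (setIidPl _) ?sub1set // => _.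
by rewrite big_set1 -eE eH.
Qed.

Theorem theorem22 (R : realType) (T : finType) (r : nat)
    (H : {set {set T}}) (V1 V2 : {set T})
    (Hunif : uniform r H)
    (HV : V1 :|: V2 = [set: T])
    (Hdisj : V1 :&: V2 = set0)
    (HV1 : forall e : {set T}, e \in H -> #|e :&: V1| = 1%N)
    (HV2 : forall e : {set T}, e \in H -> #|e :&: V2| = (r - 1)%N) :
  exists (beta : T -> R) (alpha : {set T} -> R),
    [/\ forall u : T, u \in V1 -> beta u = 0 \/ beta u = 1,
        forall e : {set T}, e \in H -> 0 <= alpha e,
        \sum_(u in V1) beta u + \sum_(e in H) alpha e
          <= (matching_number H)%:R
      & fractional_cover H (fun v : T =>
          \sum_(u in V1) beta u * charfun R [set u] v
          + \sum_(e in H) alpha e * charfun R (e :\: V1) v)].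
Proof.
have cardD e : e \in H -> r = (#|e :\: V1|).+1.
  by move=> eH; rewrite -(Hunif e eH) -(cardsID V1 e) HV1.
case: (leqP r 1) => r1.
  apply: cover_of_singletons => // e eH; rewrite (Hunif e eH).
  by have := cardD e eH; lia.
have cover_ge0 (beta : T -> R) (alpha : {set T} -> R) :
    (forall u, 0 <= beta u) -> (forall e, 0 <= alpha e) ->
    forall v, 0 <= \sum_(u in V1) beta u * charfun R [set u] v
      + \sum_(e in H) alpha e * charfun R (e :\: V1) v.
  move=> b0 a0 v; apply: addr_ge0; apply: sumr_ge0 => x _;
    by rewrite mulr_ge0 // /charfun ler0n.
(* If [V1] is small enough, all of [V1] is a cover. Otherwise the deficiency is written [d.+1], so
   that a rainbow set missing only [d] colours is one edge too large. *)
case: (leqP #|V1| (matching_number H)) => nun.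
  exists (fun=> 1), (fun=> 0); split=> //; first by right.
    by rewrite [X in _ + X]big1 // addr0 sumr_const ler_nat.
  split=> [|e eH]; first exact: cover_ge0.
  rewrite cover_weight sumr_const HV1 // lerDl big1 // => f _; exact: mul0r.
pose d := (#|V1| - matching_number H).-1.
have dE : (#|V1| = matching_number H + d.+1)%N by rewrite /d; lia.
(* Colours are optional because the vertex type is all of [{set T}]: sets that are not edges get
   [None], which is outside [C0]. *)
pose c (e : {set T}) : option T := [pick u in e :&: V1 | e \in H].
have cP e u : c e = Some u -> e \in H /\ e :&: V1 = [set u].
  rewrite /c; case: pickP => // x /andP[xe eH] [<-]; split=> //.
  by have /eqP/cards1P[y yE] := HV1 e eH; move: xe; rewrite yE in_set1 => /eqP->.
have cH e : e \in H -> exists2 u, c e = Some u & u \in V1.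
  move=> eH; have /eqP/cards1P[y yE] := HV1 e eH; exists y; last first.
    by have := set11 y; rewrite -yE inE => /andP[].
  rewrite /c; case: pickP => [x|/(_ y)]; last by rewrite yE in_set1 eqxx eH.
  by rewrite yE in_set1 => /andP[/eqP->].
pose C0 : {set option T} := Some @: V1.
have cardC0 : #|C0| = #|V1| by rewrite card_imset // => x y [].
(* The diagonal term only serves to make the conflict relation reflexive on all
   of [{set T}]: elements outside [H] have no colour in [C0]. *)
pose m (e f : {set T}) := (#|(e :\: V1) :&: (f :\: V1)| + ((e == f) && (e \notin H)))%N.
pose M (e f : {set T}) : R := (m e f)%:R.
pose a (e f : {set T}) := (0 < m e f)%N.
have msym e f : m e f = m f e by rewrite /m setIC; case: eqVneq => [->|].
have arefl : reflexive a.
  move=> e; rewrite /a /m eqxx setIid; case: (boolP (e \in H)) => eH /=.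
    by have := cardD e eH; lia.
  by rewrite addn1.
have M0 e f : 0 <= M e f by rewrite ler0n.
have Mpsd (g : {set T} -> R) : 0 <= \sum_e \sum_f M e f * (g e * g f).
  (* The form is a sum of squares: a Gram part indexed by the vertices outside [V1], and the
     diagonal part on non-edges. *)
  have -> : \sum_e \sum_f M e f * (g e * g f)
    = \sum_v (\sum_e (v \in e :\: V1)%:R * g e) ^+ 2
      + \sum_(e : {set T}) (e \notin H)%:R * g e ^+ 2.
    have -> : \sum_v (\sum_e (v \in e :\: V1)%:R * g e) ^+ 2
      = \sum_(e : {set T}) \sum_(f : {set T})
          #|(e :\: V1) :&: (f :\: V1)|%:R * (g e * g f).
      rewrite (eq_bigr (fun v => \sum_(e : {set T}) \sum_(f : {set T})
          (v \in (e :\: V1) :&: (f :\: V1))%:R * (g e * g f))); last first.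
        move=> v _; rewrite expr2 big_distrlr; apply: eq_bigr => e _.
        apply: eq_bigr => f _; rewrite [in RHS]in_setI.
        by do 2!case: (v \in _); rewrite /= ?mul1r ?mul0r ?mulr0.
      rewrite exchange_big; apply: eq_bigr => e _; rewrite exchange_big.
      apply: eq_bigr => f _; rewrite -mulr_suml -natr_sum; congr (_%:R * _).
      by rewrite -sum1_card [RHS]big_mkcond; apply: eq_bigr => v _; case: ifP.
    rewrite -big_split; apply: eq_bigr => e _ /=.
    have -> : (e \notin H)%:R * g e ^+ 2
        = \sum_f ((e == f) && (e \notin H))%:R * (g e * g f).
      rewrite (bigD1 e) //= eqxx expr2 big1 ?addr0 // => f fe.
      by rewrite eq_sym (negbTE fe) mul0r.
    by rewrite -big_split; apply: eq_bigr => f _ /=; rewrite /M /m natrD mulrDl.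
  apply: addr_ge0; apply: sumr_ge0 => x _; first exact: sqr_ge0.
  by rewrite mulr_ge0 // sqr_ge0.
have Ma e f : a e f -> 1 <= M e f by rewrite ler1n.
pose EB (B : {set option T}) : {set {set T}} := [set e | c e \in B].
have EBH (B : {set option T}) e : B \subset C0 -> e \in EB B -> e \in H.
  move=> BC; rewrite inE => /(subsetP BC)/imsetP[u _ cu].
  by have [] := cP e u cu.
have [[B BC [x [x0 Mx xB]]]|noB] := EM (exists2 B : {set option T}, B \subset C0 &
  exists x : {set T} -> R, [/\ forall j, 0 <= x j,
     forall i, i \in EB B -> 1 <= \sum_(j in EB B) M i j * x j
     & \sum_(j in EB B) x j <= #|B|%:R - d.+1%:R]).
  have sumEB (F : {set T} -> R) :
      \sum_(f in H) (if f \in EB B then x f else 0) * F f = \sum_(f in EB B) F f * x f.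
    rewrite big_mkcond [RHS]big_mkcond; apply: eq_bigr => f _.
    case: (boolP (f \in EB B)) => [fB|_]; last by rewrite mul0r if_same.
    by rewrite (EBH B) // mulrC.
  exists (fun u => (Some u \notin B)%:R), (fun e => if e \in EB B then x e else 0).
  split=> [u _|e _||].
  - by case: (_ \notin _); [right|left].
  - by case: ifP.
  - have -> : \sum_(e in H) (if e \in EB B then x e else 0) = \sum_(e in EB B) x e.
      have := sumEB (fun=> 1); under eq_bigr do rewrite mulr1.
      by move=> ->; apply: eq_bigr => e _; rewrite mul1r.
    have BE : (#|V1| = #|B| + \sum_(u in V1) (Some u \notin B))%N.
      rewrite -(cardsID [set u | Some u \in B] V1); congr (_ + _)%N.
        rewrite -(card_imset (f := Some) (V1 :&: _)); last by move=> ? ? [].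
        congr #|pred_of_set _|; apply/setP => y; apply/imsetP/idP => [[u]|yB].
          by rewrite !inE => /andP[_ uB] ->.
        have /imsetP[u uV yu] := subsetP BC y yB.
        by exists u => //; rewrite !inE uV -yu.
      rewrite -sum1_card big_mkcond [RHS]big_mkcond; apply: eq_bigr => u _.
      by rewrite !inE; case: (Some u \in B); case: (u \in V1).
    rewrite -natr_sum; move: BE; rewrite dE => /(congr1 (fun n => n%:R : R)).
    by rewrite !natrD; lra.
  - split; first by apply: cover_ge0 => // e; case: ifP.
    move=> e eH; rewrite cover_weight; have [u cu uV] := cH e eH.
    have [_ ->] := cP e u cu; rewrite big_set1 sumEB.
    case: (boolP (Some u \in B)) => uB /=; last first.
      by rewrite lerDl sumr_ge0 // => f _; rewrite mulr_ge0.
    rewrite add0r; have := Mx e; rewrite inE cu => /(_ uB).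
    congr (_ <= _); apply: eq_bigr => f _.
    by rewrite /M /m eH andbF addn0.
have [|||A [/indepP[_ Ai] AI AC cardA]] :=
    @rainbow_indep_deficiency R _ _ c a M C0 d arefl _ _ M0 Mpsd Ma.
- by move=> e f; rewrite /a msym.
- by move=> e f; rewrite /M msym.
- move=> B BC _.
  have MA i : i \in EB B -> 0 < M i i by move=> _; apply: lt_le_trans (Ma i i (arefl i)).
  have [[x xP]|[w [w0 Mw wB]]] := lp_alternative (#|B|%:R - d.+1%:R) M0 MA.
    by case: noB; exists B => //; exists x.
  exists w; split=> // [u uB|].
    have := Mw u; rewrite inE => /(_ uB); congr (_ <= _).
    by apply: eq_big => [e|e _]; rewrite ?inE // mulrC /M msym.
  by move: wB; congr (_ < _); apply: eq_bigl => e; rewrite inE.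
have AH : A \subset H.
  apply/subsetP => e eA; have /(subsetP AC)/imsetP[u _ cu] := imset_f c eA.
  by have [] := cP e u cu.
have tA : trivIset A.
  apply/trivIsetP => e f eA fA ef; rewrite -setI_eq0; apply/eqP/setP => v; rewrite !inE.
  apply/negP => /andP[ve vf].
  have [u cu _] := cH e (subsetP AH e eA); have [_ eV] := cP e u cu.
  have [u' cu' _] := cH f (subsetP AH f fA); have [_ fV] := cP f u' cu'.
  (* A common vertex in [V1] would give the two edges the same colour; one outside [V1] would be a
     conflict. *)
  case: (boolP (v \in V1)) => vV.
    have : v \in e :&: V1 by rewrite inE ve.
    have : v \in f :&: V1 by rewrite inE vf.
    rewrite eV fV !in_set1 => /eqP vu' /eqP vu.
    by case/eqP: ef; apply: AI => //; rewrite cu cu' -vu -vu'.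
  have := Ai e f eA fA ef; rewrite /a /m lt0n negbK addn_eq0 cards_eq0.
  by case/andP=> /eqP/setP/(_ v); rewrite !inE ve vf vV.
have := matching_number_ge AH tA; move: cardA; rewrite cardC0 dE addnS -addSn leq_add2r.
by move=> /leq_trans h /h; rewrite ltnn.
Qed.
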